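(* Let $(R,\tau)$ be a rigid topological ring. Then the topological dual functor $Top_{(R,\tau)}\colon \mathbf{TopFreeMod}_{(R,\tau)}^{op}\to \mathbf{FreeMod}_R$ is an equivalence of categories, with equivalence inverse the functor $Alg_{(R,\tau)}^{op}\colon \mathbf{FreeMod}_R\to \mathbf{TopFreeMod}_{(R,\tau)}^{op}$ (the opposite of the algebraic dual functor).
   Context: Rings are commutative and unital; all topologies are Hausdorff. A topological ring $(R,\tau)$ is a ring with a topology making addition, negation and multiplication (jointly) continuous. A topological $(R,\tau)$-module $(M,\sigma)$ is a unital $R$-module with a (Hausdorff) topology making addition, negation and scalar multiplication $R\times M\to M$ continuous; with continuous $R$-linear maps these form the category $\mathbf{TopMod}_{(R,\tau)}$. For a set $X$, $(R,\tau)^X$ is the module $R^X$ of all maps $X\to R$ with the product topology, and $R^{(X)}$ is the module of finitely supported maps $X\to R$. Topological dual: $(M,\sigma)'$ is the $R$-module of continuous $R$-linear maps $(M,\sigma)\to(R,\tau)$; $f'(\ell)=\ell\circ f$. Rigidity: $(R,\tau)$ is rigid if for every set $X$ the (always injective) $R$-linear map $\lambda_X\colon R^{(X)}\to ((R,\tau)^X)'$, $\lambda_X(p)(f)=\sum_{x\in X}p(x)f(x)$, is an isomorphism (i.e. onto). Algebraic dual: for an $R$-module $M$, $M^*=\mathrm{Hom}_R(M,R)$ carries the weak-$*$ topology $w^*_{(R,\tau)}$, the initial topology induced by the evaluations $M^*\to (R,\tau)$, $\ell\mapsto \ell(v)$, $v\in M$; $f^*(\ell)=\ell\circ f$. $\mathbf{FreeMod}_R$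 is the category of free $R$-modules and $R$-linear maps. $\mathbf{TopFreeMod}_{(R,\tau)}$ is the full subcategory of $\mathbf{TopMod}_{(R,\tau)}$ of topologically-free modules, i.e. those isomorphic (in $\mathbf{TopMod}_{(R,\tau)}$) to $(R,\tau)^X$ for some set $X$. For rigid $(R,\tau)$, the assignments $M\mapsto (M^*,w^*_{(R,\tau)})$, $f\mapsto f^*$ and $(M,\sigma)\mapsto (M,\sigma)'$, $f\mapsto f'$ restrict to functors $Alg_{(R,\tau)}\colon \mathbf{FreeMod}_R^{op}\to\mathbf{TopFreeMod}_{(R,\tau)}$ and $Top_{(R,\tau)}\colon \mathbf{TopFreeMod}_{(R,\tau)}^{op}\to\mathbf{FreeMod}_R$. *)

(* Defs.v *)
From HB Require Import structures.
From mathcomp Require Import all_boot all_order all_algebra finmap.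
From mathcomp Require Import boolp classical_sets functions cardinality fsbigop.
From mathcomp Require Import filter topology.

Set Implicit Arguments.
Unset Strict Implicit.
Unset Printing Implicit Defensive.

Import GRing.Theory.
Local Open Scope classical_set_scope.
Local Open Scope ring_scope.

Record category : Type := Category {
  obj :> Type ;
  hom : obj -> obj -> Type ;
  idc : forall a, hom a a ;
  compc : forall a b c, hom b c -> hom a b -> hom a c ;
  comp1c : forall a b (f : hom a b), compc (idc b) f = f ;
  compc1 : forall a b (f : hom a b), compc f (idc a) = f ;
  compcA : forall a b c d (h : hom c d) (g : hom b c) (f : hom a b),
    compc h (compc g f) = compc (compc h g) f }.
Arguments hom {_} _ _ : rename.
Arguments idc {_} _ : rename.
Arguments compc {_ _ _ _} _ _ : rename.

Definition is_iso (C : category) (a b : C) (f : hom a b) : Prop :=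
  exists g : hom b a, compc g f = idc a /\ compc f g = idc b.

Definition isomorphic (C : category) (a b : C) : Prop :=
  exists f : hom a b, is_iso f.

Definition op_cat (C : category) : category :=
  @Category C (fun a b => hom b a) idc (fun a b c g f => compc f g)
    (fun a b f => compc1 f) (fun a b f => comp1c f)
    (fun a b c d h g f => esym (compcA f g h)).

Definition full_subcat (C : category) (P : C -> Prop) : category :=
  @Category {a : C | P a} (fun a b => hom (sval a) (sval b))
    (fun a => idc (sval a)) (fun a b c g f => compc g f)
    (fun a b f => comp1c f) (fun a b f => compc1 f)
    (fun a b c d h g f => compcA h g f).

Record functor (C D : category) : Type := Functor {
  fobj :> C -> D ;
  fmap : forall a b : C, hom a b -> hom (fobj a) (fobj b) ;
  fmap1 : forall a : C, fmap (idc a) = idc (fobj a) ;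
  fmapM : forall (a b c : C) (g : hom b c) (f : hom a b),
    fmap (compc g f) = compc (fmap g) (fmap f) }.
Arguments fmap {_ _} _ {_ _} _ : rename.

Definition id_functor (C : category) : functor C C :=
  @Functor C C (fun a => a) (fun a b f => f)
    (fun a => erefl) (fun a b c g f => erefl).

Section functor_constructions.
Variables C D E : category.

Definition comp_functor (G : functor D E) (F : functor C D) : functor C E :=
  @Functor C E (fun a => G (F a)) (fun a b f => fmap G (fmap F f))
    (fun a => etrans (congr1 (fmap G) (fmap1 F a)) (fmap1 G (F a)))
    (fun a b c g f =>
      etrans (congr1 (fmap G) (fmapM F g f)) (fmapM G (fmap F g) (fmap F f))).

(* The opposite of F, with op_cat (op_cat C), which is not convertible to C,
   replaced by C as source. *)
Definition op_functor (F : functor (op_cat C) D) : functor C (op_cat D) :=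
  @Functor C (op_cat D) F (fun a b f => @fmap _ _ F b a f)
    (fun a => fmap1 F a) (fun a b c g f => @fmapM _ _ F c b a f g).

Definition restrict_functor (F : functor (op_cat C) D) (P : C -> Prop)
    (Q : D -> Prop) (PQ : forall a, P a -> Q (F a)) :
    functor (op_cat (full_subcat P)) (full_subcat Q) :=
  @Functor (op_cat (full_subcat P)) (full_subcat Q)
    (fun a => exist Q (F (sval a)) (PQ (sval a) (svalP a)))
    (fun a b f => @fmap _ _ F (sval a) (sval b) f)
    (fun a => fmap1 F (sval a))
    (fun a b c g f => @fmapM _ _ F (sval a) (sval b) (sval c) g f).

End functor_constructions.
Arguments restrict_functor {C D} F {P Q} PQ.

Definition nat_iso (C D : category) (F G : functor C D) : Prop :=
  exists eta : forall a : C, hom (F a) (G a),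
    (forall a, is_iso (eta a)) /\
    (forall (a b : C) (f : hom a b),
      compc (eta b) (fmap F f) = compc (fmap G f) (eta a)).

Definition equivalence_inverse (C D : category)
    (F : functor C D) (G : functor D C) : Prop :=
  nat_iso (id_functor C) (comp_functor G F) /\
  nat_iso (comp_functor F G) (id_functor D).

Definition is_equivalence (C D : category) (F : functor C D) : Prop :=
  exists G : functor D C, equivalence_inverse F G.

Lemma functor_isomorphic (C D : category) (F : functor (op_cat C) D) (a b : C) :
  isomorphic a b -> isomorphic (F a) (F b).
Proof.
move=> [f [g [gf fg]]]; exists (@fmap _ _ F a b g), (@fmap _ _ F b a f).
split.
  by rewrite -(@fmapM _ _ F a b a f g) /= gf; exact: fmap1.
by rewrite -(@fmapM _ _ F b a b g f) /= fg; exact: fmap1.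
Qed.

Lemma isomorphic_trans (C : category) (a b c : C) :
  isomorphic a b -> isomorphic b c -> isomorphic a c.
Proof.
move=> [f [f' [f'f ff']]] [g [g' [g'g gg']]].
exists (compc g f), (compc f' g'); split.
  by rewrite -compcA (compcA g' g f) g'g comp1c.
by rewrite -compcA (compcA f f' g') ff' comp1c.
Qed.

Lemma isomorphic_sym (C : category) (a b : C) : isomorphic a b -> isomorphic b a.
Proof. by move=> [f [g [gf fg]]]; exists g, f. Qed.

HB.mixin Record isTopologicalGroup M of Topological M & GRing.Zmodule M := {
  addr_continuous : continuous (fun z : M * M => z.1 + z.2) ;
  oppr_continuous : continuous (fun x : M => - x) ;
  is_hausdorff : hausdorff_space M }.

#[short(type="topGroupType")]
HB.structure Definition TopGroup :=
  {M of Topological M & GRing.Zmodule M & isTopologicalGroup M}.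

(* PzRing allows 1 = 0. *)
HB.mixin Record isTopologicalRing R of TopGroup R & GRing.PzRing R := {
  mulr_continuous : continuous (fun z : R * R => z.1 * z.2) }.

#[short(type="topComRingType")]
HB.structure Definition TopComRing :=
  {R of TopGroup R & GRing.ComPzRing R & isTopologicalRing R}.

HB.mixin Record isTopologicalModule (R : topComRingType) M
    of TopGroup M & GRing.Lmodule R M := {
  scaler_continuous : continuous (fun z : R * M => z.1 *: z.2) }.

#[short(type="topModType")]
HB.structure Definition TopModule (R : topComRingType) :=
  {M of TopGroup M & GRing.Lmodule R M & isTopologicalModule R M}.

Lemma linear_ext (R : pzRingType) (U : lmodType R) (V : zmodType)
  (s : R -> V -> V) (f g : {linear U -> V | s}) : f =1 g -> f = g.
Proof.
case: f g => [f [[nf] [sf]]] [g [[ng] [sg]]] /= /funext efg.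
by subst g; rewrite (Prop_irrelevance sf sg); case: nf ng => [a b] [c d];
   rewrite (Prop_irrelevance a c) (Prop_irrelevance b d).
Qed.

Lemma continuous_addf (T : topologicalType) (M : topGroupType) (f g : T -> M) :
  continuous f -> continuous g -> continuous (fun x => f x + g x).
Proof.
move=> fc gc x; apply: (@continuous_comp T (M * M)%type M
  (fun x => (f x, g x)) (fun z => z.1 + z.2)); last exact: addr_continuous.
by apply: cvg_pair; [exact: fc|exact: gc].
Qed.

Lemma continuous_mulf (T : topologicalType) (R : topComRingType) (f g : T -> R) :
  continuous f -> continuous g -> continuous (fun x => f x * g x).
Proof.
move=> fc gc x; apply: (@continuous_comp T (R * R)%type R
  (fun x => (f x, g x)) (fun z => z.1 * z.2)); last exact: mulr_continuous.
by apply: cvg_pair; [exact: fc|exact: gc].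
Qed.

Section pack_linear.
Variables (R : pzRingType) (U : lmodType R) (V : zmodType).
Variables (s : GRing.Scale.law R V) (f : U -> V) (fP : linear_for s f).
Let g : U -> V := f.
HB.instance Definition _ := GRing.isLinear.Build R U V s g fP.
Definition pack_linear : {linear U -> V | s} := g.
End pack_linear.

Lemma linear_comp1f (R : pzRingType) (M N : lmodType R) (f : {linear M -> N}) :
  idfun \o f = f :> {linear M -> N}.
Proof. exact: linear_ext. Qed.

Lemma linear_compf1 (R : pzRingType) (M N : lmodType R) (f : {linear M -> N}) :
  f \o idfun = f :> {linear M -> N}.
Proof. exact: linear_ext. Qed.

Lemma linear_compA (R : pzRingType) (M N P Q : lmodType R)
    (h : {linear P -> Q}) (g : {linear N -> P}) (f : {linear M -> N}) :
  h \o (g \o f) = (h \o g) \o f :> {linear M -> Q}.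
Proof. exact: linear_ext. Qed.

Definition Mod (R : pzRingType) : category :=
  @Category (lmodType R) (fun M N => {linear M -> N}) (fun M => idfun)
    (fun M N P g f => g \o f)
    (@linear_comp1f R) (@linear_compf1 R) (@linear_compA R).

Record contLinear (R : topComRingType) (M N : topModType R) := ContLinear {
  clin :> {linear M -> N} ;
  clinP : continuous clin }.

Lemma contLinear_ext (R : topComRingType) (M N : topModType R)
  (f g : contLinear M N) : f =1 g -> f = g.
Proof.
case: f g => [f fc] [g gc] /= /linear_ext fg.
by subst g; rewrite (Prop_irrelevance fc gc).
Qed.

Definition contLinear_id (R : topComRingType) (M : topModType R) :
  contLinear M M := @ContLinear R M M idfun (fun x => @cvg_id _ _).

Definition contLinear_comp (R : topComRingType) (M N P : topModType R)
    (g : contLinear N P) (f : contLinear M N) : contLinear M P :=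
  @ContLinear R M P (clin g \o clin f)
    (fun x => continuous_comp (@clinP _ _ _ f x) (@clinP _ _ _ g (f x))).

Lemma contLinear_comp1f (R : topComRingType) (M N : topModType R)
  (f : contLinear M N) : contLinear_comp (contLinear_id N) f = f.
Proof. exact: contLinear_ext. Qed.

Lemma contLinear_compf1 (R : topComRingType) (M N : topModType R)
  (f : contLinear M N) : contLinear_comp f (contLinear_id M) = f.
Proof. exact: contLinear_ext. Qed.

Lemma contLinear_compA (R : topComRingType) (M N P Q : topModType R)
    (h : contLinear P Q) (g : contLinear N P) (f : contLinear M N) :
  contLinear_comp h (contLinear_comp g f)
  = contLinear_comp (contLinear_comp h g) f.
Proof. exact: contLinear_ext. Qed.

Definition TopMod (R : topComRingType) : category :=
  @Category (topModType R) (@contLinear R) (@contLinear_id R)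
    (@contLinear_comp R) (@contLinear_comp1f R) (@contLinear_compf1 R)
    (@contLinear_compA R).

Lemma initial_cvg (S : choiceType) (T : topologicalType) (f : S -> T)
    (F : set_system S) (s : S) : Filter F ->
  (F --> (s : initial_topology f)) <-> (f @ F --> f s).
Proof.
move=> FF; split=> [Fs|Fs].
  apply: cvg_trans (cvg_app f Fs) _.
  exact: (@initial_continuous S T f s).
move=> A; rewrite nbhsE => -[B [[C oC CB] Bs] BA].
rewrite nbhs_filterE; apply: filterS BA _; rewrite -CB.
by apply: Fs; apply: open_nbhs_nbhs; split=> //; move: Bs; rewrite -CB.
Qed.

Lemma sup_initial_cvg (S : choiceType) (I : Type) (T : I -> topologicalType)
    (f : forall i, S -> T i) (F : set_system S) (s : S) : Filter F ->
  (F --> (s : sup_topology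
    (fun i => Topological.class (initial_topology (f i))))) <->
  (forall i, f i @ F --> f i s).
Proof.
move=> FF; rewrite cvg_sup; split=> H i; have := H i.
  by rewrite (initial_cvg (f i) s FF).
by rewrite -(initial_cvg (f i) s FF).
Qed.

Definition funpow (R : Type) (X : Type) : Type := {ptws X -> R}.

Section funpow.
Variables (R : topComRingType) (X : Type).

HB.instance Definition _ := Topological.on (funpow R X).
HB.instance Definition _ :=
  GRing.Lmodule.copy (funpow R X) (X -> (R^o : lmodType R)).

Lemma funpow_cvg (F : set_system (funpow R X)) (f : funpow R X) : Filter F ->
  (F --> f) <-> (forall x, (fun g : funpow R X => g x) @ F --> f x).
Proof. by move=> FF; apply: sup_initial_cvg. Qed.

End funpow.

(* Convergence in the initial topology of e; only a proof device. *)
Definition is_initial (R : topComRingType) (S : topologicalType) (I : Type)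
    (e : I -> S -> R) : Prop :=
  forall (F : set_system S) (s : S), Filter F ->
    (F --> s) <-> (forall i, e i @ F --> e i s).

Section is_initial.
Variables (R : topComRingType) (S : topologicalType) (I : Type).
Variables (e : I -> S -> R) (eS : is_initial e).

Lemma is_initial_eval i : continuous (e i).
Proof. by move=> s; apply: (eS s _).1; exact: cvg_id. Qed.

Lemma is_initial_cont (T : topologicalType) (g : T -> S) :
  (forall i, continuous (e i \o g)) -> continuous g.
Proof. by move=> h t; apply/(eS _ _) => i; exact: (h i t). Qed.

Lemma is_initial_hausdorff :
  (forall s t, (forall i, e i s = e i t) -> s = t) -> hausdorff_space S.
Proof.
move=> inj s t st; apply: inj => i; apply: is_hausdorff => A B As Bt.
have [u [Au Bu]] := st _ _ (is_initial_eval As) (is_initial_eval Bt).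
by exists (e i u).
Qed.

Lemma is_initial_add (add : S -> S -> S) :
  (forall i s t, e i (add s t) = e i s + e i t) ->
  continuous (fun z : S * S => add z.1 z.2).
Proof.
move=> eD; apply: is_initial_cont => i.
rewrite (_ : _ \o _ = (fun z => z.1 + z.2) \o
  (fun z : S * S => (e i z.1, e i z.2))); last by apply/funext => z /=.
move=> z; apply: continuous_comp; last exact: addr_continuous.
by apply: cvg_pair => /=; apply: (continuous_comp _ (@is_initial_eval i _));
  [exact: cvg_fst|exact: cvg_snd].
Qed.

Lemma is_initial_opp (opp : S -> S) :
  (forall i s, e i (opp s) = - e i s) -> continuous opp.
Proof.
move=> eN; apply: is_initial_cont => i.
rewrite (_ : _ \o _ = -%R \o e i); last by apply/funext => z /=.
move=> z; apply: continuous_comp; first exact: is_initial_eval.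
exact: oppr_continuous.
Qed.

Lemma is_initial_scale (scale : R -> S -> S) :
  (forall i a s, e i (scale a s) = a * e i s) ->
  continuous (fun z : R * S => scale z.1 z.2).
Proof.
move=> eZ; apply: is_initial_cont => i.
rewrite (_ : _ \o _ = (fun z => z.1 * z.2) \o
  (fun z : R * S => (z.1, e i z.2))); last by apply/funext => z /=.
move=> z; apply: continuous_comp; last exact: mulr_continuous.
apply: cvg_pair => /=; first exact: cvg_fst.
by apply: (continuous_comp _ (@is_initial_eval i _)); exact: cvg_snd.
Qed.

End is_initial.

Section funpow_topmod.
Variables (R : topComRingType) (X : Type).

Definition funpow_eval (x : X) (f : funpow R X) : R := f x.

Lemma funpow_initial : is_initial funpow_eval.
Proof. by move=> F s FF; exact: funpow_cvg. Qed.

HB.instance Definition _ := isTopologicalGroup.Build (funpow R X)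
  (is_initial_add funpow_initial (fun i s t => erefl))
  (is_initial_opp funpow_initial (fun i s => erefl))
  (is_initial_hausdorff funpow_initial (fun s t => @funext _ _ s t)).

HB.instance Definition _ := isTopologicalModule.Build R (funpow R X)
  (is_initial_scale funpow_initial (fun i a s => erefl)).

End funpow_topmod.

(* {scalar M} rather than {linear M -> R^o}: the values stay in R, which carries
   the topology. *)
Definition algdual (R : comPzRingType) (M : lmodType R) : Type := {scalar M}.

Section algdual.
Variables (R : comPzRingType) (M : lmodType R).

HB.instance Definition _ := gen_eqMixin (algdual M).
HB.instance Definition _ := gen_choiceMixin (algdual M).

Definition algdual_zero : algdual M := \0 : {scalar M}.
Definition algdual_opp (l : algdual M) : algdual M := \- l : {scalar M}.
Definition algdual_add (k l : algdual M) : algdual M := k \+ l : {scalar M}.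

Fact algdual_scale_scalar (a : R) (l : algdual M) : scalar (fun v => a * l v).
Proof. by move=> b u v /=; rewrite scalarP mulrDr mulrCA. Qed.
Definition algdual_scale (a : R) (l : algdual M) : algdual M :=
  pack_linear (algdual_scale_scalar a l).

Fact algdual_addA : associative algdual_add.
Proof. by move=> k l m; apply: linear_ext => v /=; rewrite addrA. Qed.
Fact algdual_addC : commutative algdual_add.
Proof. by move=> k l; apply: linear_ext => v /=; rewrite addrC. Qed.
Fact algdual_add0 : left_id algdual_zero algdual_add.
Proof. by move=> k; apply: linear_ext => v /=; rewrite add0r. Qed.
Fact algdual_addN : left_inverse algdual_zero algdual_opp algdual_add.
Proof. by move=> k; apply: linear_ext => v /=; rewrite addNr. Qed.

HB.instance Definition _ := GRing.isZmodule.Build (algdual M)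
  algdual_addA algdual_addC algdual_add0 algdual_addN.

Fact algdual_scaleA a b (l : algdual M) :
  algdual_scale a (algdual_scale b l) = algdual_scale (a * b) l.
Proof. by apply: linear_ext => v /=; rewrite mulrA. Qed.
Fact algdual_scale1 : left_id 1 algdual_scale.
Proof. by move=> l; apply: linear_ext => v /=; rewrite mul1r. Qed.
Fact algdual_scaleDr : right_distributive algdual_scale +%R.
Proof. by move=> a k l; apply: linear_ext => v /=; rewrite mulrDr. Qed.
Fact algdual_scaleDl (l : algdual M) : {morph algdual_scale^~ l : a b / a + b}.
Proof. by move=> a b; apply: linear_ext => v /=; rewrite mulrDl. Qed.

HB.instance Definition _ := GRing.Zmodule_isLmodule.Build R (algdual M)
  algdual_scaleA algdual_scale1 algdual_scaleDr algdual_scaleDl.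

End algdual.

Section weak_star.
Variables (R : topComRingType) (M : lmodType R).

(* The weak-* topology is the supremum of the initial topologies of the
   evaluations, as in the library's prod_topology. *)
Definition algdual_eval (v : M) (l : algdual M) : R := (l : {scalar M}) v.

HB.instance Definition _ := Topological.copy (algdual M)
  (sup_topology (fun v : M =>
     Topological.class (initial_topology (algdual_eval v)))).

Lemma algdual_initial : is_initial algdual_eval.
Proof. by move=> F s FF; exact: sup_initial_cvg. Qed.

Fact algdual_eval_inj (k l : algdual M) :
  (forall v, algdual_eval v k = algdual_eval v l) -> k = l.
Proof. by move=> kl; exact: linear_ext. Qed.

Fact algdual_evalD v (k l : algdual M) :
  algdual_eval v (k + l) = algdual_eval v k + algdual_eval v l.
Proof. by []. Qed.

Fact algdual_evalN v (l : algdual M) :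
  algdual_eval v (- l) = - algdual_eval v l.
Proof. by []. Qed.

Fact algdual_evalZ v a (l : algdual M) :
  algdual_eval v (a *: l) = a * algdual_eval v l.
Proof. by []. Qed.

HB.instance Definition _ := isTopologicalGroup.Build (algdual M)
  (is_initial_add algdual_initial algdual_evalD)
  (is_initial_opp algdual_initial algdual_evalN)
  (is_initial_hausdorff algdual_initial algdual_eval_inj).

HB.instance Definition _ := isTopologicalModule.Build R (algdual M)
  (is_initial_scale algdual_initial algdual_evalZ).

End weak_star.

Section algdual_map.
Variables (R : topComRingType) (M N : lmodType R) (f : {linear M -> N}).

Definition algdual_map_fun (l : algdual N) : algdual M :=
  (l : {scalar N}) \o f.

Fact algdual_map_linear : linear algdual_map_fun.
Proof. by move=> a k l; apply: linear_ext. Qed.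

Fact algdual_map_continuous : continuous (pack_linear algdual_map_linear).
Proof.
apply: (is_initial_cont (@algdual_initial R M)) => v.
exact: (@is_initial_eval _ _ _ _ (@algdual_initial R N) (f v)).
Qed.

Definition algdual_map : contLinear (algdual N) (algdual M) :=
  ContLinear algdual_map_continuous.

End algdual_map.

Fact algdual_map1 (R : topComRingType) (M : lmodType R) :
  algdual_map (idfun : {linear M -> M}) = contLinear_id (algdual M).
Proof. by apply: contLinear_ext => l; apply: linear_ext. Qed.

Fact algdual_mapM (R : topComRingType) (M N P : lmodType R)
    (g : {linear P -> N}) (f : {linear M -> P}) :
  algdual_map (g \o f) = contLinear_comp (algdual_map f) (algdual_map g).
Proof. by apply: contLinear_ext => l; apply: linear_ext. Qed.

Definition AlgDual (R : topComRingType) : functor (op_cat (Mod R)) (TopMod R) :=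
  @Functor (op_cat (Mod R)) (TopMod R) (fun M : lmodType R => algdual M)
    (fun M N f => algdual_map f) (@algdual_map1 R)
    (fun M N P g f => algdual_mapM f g).

Section topdual.
Variables (R : topComRingType) (M : topModType R).

Definition contdual : {pred algdual M} :=
  [pred l : algdual M | `[< continuous ((l : {scalar M}) : M -> R) >]].

Fact contdualP (l : algdual M) :
  l \in contdual <-> continuous ((l : {scalar M}) : M -> R).
Proof. by split=> [/asboolP|?]; [|apply/asboolP]. Qed.

Fact contdual_submod : submod_closed contdual.
Proof.
split=> [|a k l]; first by apply/contdualP => x; exact: cvg_cst.
move=> /contdualP kc /contdualP lc; apply/contdualP.
apply: (continuous_addf _ lc); apply: continuous_mulf kc.
exact: cst_continuous.
Qed.

HB.instance Definition _ :=
  GRing.isSubmodClosed.Build R (algdual M) contdual contdual_submod.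

Definition topdual : Type := {l : algdual M | l \in contdual}.

HB.instance Definition _ := [isSub for @sval _ _ : topdual -> algdual M].
HB.instance Definition _ := [Choice of topdual by <:].
HB.instance Definition _ := [SubChoice_isSubLmodule of topdual by <:].

End topdual.

Arguments contdual {R} M : rename.

Section topdual_map.
Variables (R : topComRingType) (M N : topModType R) (f : contLinear M N).

Fact topdual_map_subproof (l : topdual N) : algdual_map f (val l) \in contdual M.
Proof.
have /contdualP lc := valP l; apply/contdualP => x /=.
by apply: continuous_comp; [exact: clinP|exact: lc].
Qed.

Definition topdual_map_fun (l : topdual N) : topdual M :=
  Sub (algdual_map f (val l)) (topdual_map_subproof l).

Fact topdual_map_linear : linear topdual_map_fun.
Proof. by move=> a k l; apply: val_inj; apply: linear_ext. Qed.

Definition topdual_map : {linear topdual N -> topdual M} :=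
  pack_linear topdual_map_linear.

End topdual_map.

Fact topdual_map1 (R : topComRingType) (M : topModType R) :
  topdual_map (contLinear_id M) = idfun.
Proof. by apply: linear_ext => l; apply: val_inj; exact: linear_ext. Qed.

Fact topdual_mapM (R : topComRingType) (M N P : topModType R)
    (g : contLinear P N) (f : contLinear M P) :
  topdual_map (contLinear_comp g f) = topdual_map f \o topdual_map g.
Proof. by apply: linear_ext => l; apply: val_inj; exact: linear_ext. Qed.

Definition TopDual (R : topComRingType) : functor (op_cat (TopMod R)) (Mod R) :=
  @Functor (op_cat (TopMod R)) (Mod R) (fun M : topModType R => topdual M)
    (fun M N f => topdual_map f) (@topdual_map1 R)
    (fun M N P g f => topdual_mapM f g).

Section fspow.
Variables (R : comPzRingType) (X : Type).

Definition fsupported : {pred X -> R^o} :=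
  [pred p : X -> R^o | `[< finite_set [set x | p x <> 0] >]].

Fact fsupportedP (p : X -> R^o) :
  p \in fsupported <-> finite_set [set x | p x <> 0].
Proof. by split=> [/asboolP|?]; [|apply/asboolP]. Qed.

Fact fsupported_submod : submod_closed fsupported.
Proof.
split=> [|a p q].
  apply/fsupportedP; rewrite (_ : [set _ | _] = set0) //.
  by apply/seteqP; split.
move=> /fsupportedP fp /fsupportedP fq; apply/fsupportedP.
apply: (@sub_finite_set _ _ ([set x | p x <> 0] `|` [set x | q x <> 0])).
  move=> x /= apq; apply: contrapT => /not_orP [/contrapT px /contrapT qx].
  by apply: apq; rewrite [LHS](_ : _ = a * p x + q x) // px qx mulr0 addr0.
by rewrite finite_setU.
Qed.

HB.instance Definition _ :=
  GRing.isSubmodClosed.Build R (X -> R^o) fsupported fsupported_submod.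

Definition fspow : Type := {p : X -> R^o | p \in fsupported}.

HB.instance Definition _ := [isSub for @sval _ _ : fspow -> (X -> R^o)].
HB.instance Definition _ := [Choice of fspow by <:].
HB.instance Definition _ := [SubChoice_isSubLmodule of fspow by <:].

End fspow.

Section fspow_theory.
Variables (R : comPzRingType) (X : Type).
Implicit Types p q : fspow R X.

Definition fspow_coef p (x : X) : R := val p x.
Local Notation coef := fspow_coef.

Fact fspow_support p : exists A : {fset {classic X}},
  forall x : {classic X}, x \notin A -> coef p x = 0.
Proof.
have /fsupportedP pf := valP p.
exists (fset_set ([set x | coef p x <> 0] : set {classic X})) => x.
by rewrite in_fset_set // notin_setE /= => /contrapT.
Qed.

(* The sum is finite by fspow_support; {classic X} is X with a choice
   structure, needed to index it. *)
Definition pairing p (f : X -> R) : R :=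
  \sum_(x \in [set: {classic X}]) coef p x * f x.

Fact pairingE p (A : {fset {classic X}}) (f : X -> R) :
    (forall x : {classic X}, x \notin A -> coef p x = 0) ->
  pairing p f = \sum_(x <- A) coef p x * f x.
Proof. by move=> pA; apply: fsbigTE => x /pA ->; rewrite mul0r. Qed.

Fact pairing_linearr p a (f g : X -> R) :
  pairing p (fun x => a * f x + g x) = a * pairing p f + pairing p g.
Proof.
have [A pA] := fspow_support p.
rewrite !(pairingE _ pA) big_distrr -big_split /=; apply: eq_bigr => x _.
by rewrite mulrDr mulrCA.
Qed.

Fact pairing_linearl a p q (f : X -> R) :
  pairing (a *: p + q) f = a * pairing p f + pairing q f.
Proof.
have [A pA] := fspow_support p; have [B qB] := fspow_support q.
have pAB (x : {classic X}) : x \notin (A `|` B)%fset -> coef p x = 0.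
  by rewrite inE negb_or => /andP[/pA].
have qAB (x : {classic X}) : x \notin (A `|` B)%fset -> coef q x = 0.
  by rewrite inE negb_or => /andP[_ /qB].
have E x : coef (a *: p + q) x = a * coef p x + coef q x by [].
rewrite (pairingE _ pAB) (pairingE _ qAB) (@pairingE _ (A `|` B)%fset); last first.
  by move=> x xAB; rewrite E pAB // qAB // mulr0 addr0.
rewrite big_distrr -big_split /=; apply: eq_bigr => x _.
by rewrite E mulrDl mulrA.
Qed.

Fact fspow_dirac_subproof (x : X) :
  (fun y => (`[< y = x >] : nat)%:R) \in @fsupported R X.
Proof.
apply/fsupportedP; apply: (@sub_finite_set _ _ [set x]); last exact: finite_set1.
by move=> y /=; case: asboolP.
Qed.

Definition fspow_dirac (x : X) : fspow R X :=
  exist (fun u : X -> R^o => u \in @fsupported R X) _ (fspow_dirac_subproof x).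

Fact fspow_coef_dirac x y : coef (fspow_dirac x) y = (`[< y = x >] : nat)%:R.
Proof. by []. Qed.

Fact pairing_dirac x (f : X -> R) : pairing (fspow_dirac x) f = f x.
Proof.
rewrite (@pairingE _ [fset (x : {classic X})]%fset) => [|y]; last first.
  by rewrite inE fspow_coef_dirac; case: asboolP => // ->; rewrite eqxx.
by rewrite big_seq_fset1 fspow_coef_dirac; case: asboolP => // _; rewrite mul1r.
Qed.

Fact fspow_ext p q : coef p =1 coef q -> p = q.
Proof.
move=> /funext pq; case: p q pq => [p pP] [q qP]; rewrite /fspow_coef /= => pq.
have {}pq : p = q by exact: pq.
by subst q; rewrite (Prop_irrelevance pP qP).
Qed.

Fact fspow_coef_sum (I : Type) (r : seq I) (F : I -> fspow R X) y :
  coef (\sum_(i <- r) F i) y = \sum_(i <- r) coef (F i) y.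
Proof.
by elim: r => [|i r IH]; rewrite ?big_nil // !big_cons -IH.
Qed.

Fact fspow_sum p (A : {fset {classic X}}) :
  (forall x : {classic X}, x \notin A -> coef p x = 0) ->
  p = \sum_(x <- A) coef p x *: fspow_dirac x.
Proof.
move=> pA; apply: fspow_ext => y; rewrite fspow_coef_sum.
transitivity (\sum_(x <- A) coef p x * (`[< y = x >] : nat)%:R); last by [].
have [yA|yA] := boolP ((y : {classic X}) \in A).
  rewrite (big_fsetD1 (y : {classic X})) //=.
  rewrite big_seq big1 ?addr0; first by case: asboolP => // _; rewrite mulr1.
  by move=> x; rewrite !inE; case: asboolP => [->|_ _]; rewrite ?eqxx ?mulr0.
rewrite pA // big_seq big1 // => x xA.
by case: asboolP => [yx|_]; [move: yA; rewrite yx xA|rewrite mulr0].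
Qed.

End fspow_theory.

Section lambda.
Variables (R : topComRingType) (X : Type).

Fact finite_sum_continuous (a : X -> R) (s : seq X) :
  continuous (fun f : funpow R X => \sum_(x <- s) a x * f x).
Proof.
elim: s => [|x s IH].
  rewrite (_ : (fun f : funpow R X => _) = cst 0); first exact: cst_continuous.
  by apply/funext => g; rewrite big_nil.
rewrite (_ : (fun f : funpow R X => _) =
  (fun f : funpow R X => a x * f x + \sum_(x <- s) a x * f x)); last first.
  by apply/funext => g; rewrite big_cons.
apply: continuous_addf IH; apply: continuous_mulf; first exact: cst_continuous.
exact: (@is_initial_eval _ _ _ _ (@funpow_initial R X) x).
Qed.

Fact lambda_scalar (p : fspow R X) : scalar (pairing p : funpow R X -> R).
Proof. by move=> a f g; exact: pairing_linearr. Qed.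

Fact lambda_continuous (p : fspow R X) :
  (pack_linear (lambda_scalar p) : algdual (funpow R X)) \in contdual _.
Proof.
apply/contdualP; have [A pA] := fspow_support p.
rewrite (_ : GRing.Linear.sort _ =
  fun f : funpow R X => \sum_(x <- A) fspow_coef p x * f x); last first.
  by apply/funext => f; exact: pairingE.
exact: finite_sum_continuous.
Qed.

Definition lambda_fun (p : fspow R X) : topdual (funpow R X) :=
  exist (fun l : algdual (funpow R X) => l \in contdual _) _
    (lambda_continuous p).

Fact lambda_linear : linear lambda_fun.
Proof.
move=> a p q; apply: val_inj; apply: linear_ext => f.
exact: pairing_linearl.
Qed.

Definition lambda : {linear fspow R X -> topdual (funpow R X)} :=
  pack_linear lambda_linear.

End lambda.
Arguments lambda R X : clear implicits.

Definition rigid (R : topComRingType) : Prop :=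
  forall X : Type, is_iso (lambda R X : @hom (Mod R) _ _).

Definition free_module (R : comPzRingType) (M : lmodType R) : Prop :=
  exists X : Type, @isomorphic (Mod R) M (fspow R X).

Definition topfree_module (R : topComRingType) (M : topModType R) : Prop :=
  exists X : Type, @isomorphic (TopMod R) M (funpow R X).

Definition FreeMod (R : comPzRingType) : category :=
  @full_subcat (Mod R) (@free_module R).

Definition TopFreeMod (R : topComRingType) : category :=
  @full_subcat (TopMod R) (@topfree_module R).

Section algdual_fspow.
Variables (R : topComRingType) (X : Type).

Definition algdual_fspow_coord (l : algdual (fspow R X)) : funpow R X :=
  fun x => (l : {scalar fspow R X}) (fspow_dirac R x).

Fact algdual_fspow_coord_linear : linear algdual_fspow_coord.
Proof. by []. Qed.

Fact algdual_fspow_coord_continuous :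
  continuous (pack_linear algdual_fspow_coord_linear).
Proof.
apply: (is_initial_cont (@funpow_initial R X)) => x.
exact: (@is_initial_eval _ _ _ _ (@algdual_initial R (fspow R X))
  (fspow_dirac R x)).
Qed.

Fact pairing_scalar (f : funpow R X) : scalar (fun p : fspow R X => pairing p f).
Proof. by move=> a p q; exact: pairing_linearl. Qed.

Definition funpow_form (f : funpow R X) : algdual (fspow R X) :=
  pack_linear (pairing_scalar f).

Fact funpow_form_linear : linear funpow_form.
Proof.
by move=> a f g; apply: linear_ext => p; exact: pairing_linearr.
Qed.

Fact funpow_form_continuous : continuous (pack_linear funpow_form_linear).
Proof.
apply: (is_initial_cont (@algdual_initial R (fspow R X))) => p.
have [A pA] := fspow_support p.
rewrite (_ : _ \o _ =
  fun f : funpow R X => \sum_(x <- A) fspow_coef p x * f x); last first.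
  by apply/funext => f; exact: pairingE.
exact: finite_sum_continuous.
Qed.

Lemma algdual_fspow_iso :
  @isomorphic (TopMod R) (algdual (fspow R X)) (funpow R X).
Proof.
exists (ContLinear algdual_fspow_coord_continuous).
exists (ContLinear funpow_form_continuous); split; apply: contLinear_ext.
  move=> l; apply: linear_ext => p.
  have [A pA] := fspow_support p.
  rewrite [in RHS](fspow_sum pA) linear_sum /= (pairingE _ pA).
  by apply: eq_bigr => x _; rewrite scalarZ.
by move=> f; apply/funext => x; exact: pairing_dirac.
Qed.

End algdual_fspow.

Lemma algdual_topfree (R : topComRingType) (M : lmodType R) :
  free_module M -> topfree_module (AlgDual R M).
Proof.
move=> [X MX]; exists X.
apply: (isomorphic_trans (functor_isomorphic (AlgDual R) MX)).
exact: algdual_fspow_iso.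
Qed.

Lemma topdual_free (R : topComRingType) : rigid R ->
  forall M : topModType R, topfree_module M -> free_module (TopDual R M).
Proof.
move=> rR M [X MX]; exists X.
apply: (isomorphic_trans (functor_isomorphic (TopDual R) MX)).
by apply: isomorphic_sym; exists (lambda R X); exact: rR.
Qed.

Definition Alg (R : topComRingType) :
    functor (op_cat (FreeMod R)) (TopFreeMod R) :=
  restrict_functor (AlgDual R) (@algdual_topfree R).

Definition Top (R : topComRingType) (rigR : rigid R) :
    functor (op_cat (TopFreeMod R)) (FreeMod R) :=
  restrict_functor (TopDual R) (topdual_free rigR).

(* Main.v *)
From mathcomp Require Import all_boot all_algebra.
From mathcomp Require Import boolp classical_sets filter topology.
Require Import Defs.

(* Both units are evaluation maps into a double dual, [M -> M'*] and
   [N -> N*'].  Being natural, they need only be inverted on [R^X] and [R^(X)].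
   Up to the isomorphism [R^(X)* ~ R^X], transposing [lambda] turns the first
   into the identity of [R^X], and the second is [lambda] itself; rigidity says
   that [lambda] is invertible. *)

Set Implicit Arguments.
Unset Strict Implicit.
Unset Printing Implicit Defensive.

Import GRing.Theory.
Local Open Scope ring_scope.

Lemma is_iso_id (C : category) (a : C) : is_iso (idc a).
Proof. by exists (idc a); rewrite comp1c. Qed.

Lemma is_iso_comp (C : category) (a b c : C) (g : hom b c) (f : hom a b) :
  is_iso g -> is_iso f -> is_iso (compc g f).
Proof.
move=> [g' [g'g gg']] [f' [f'f ff']]; exists (compc f' g'); split.
  by rewrite -compcA (compcA g' g f) g'g comp1c.
by rewrite -compcA (compcA f f' g') ff' comp1c.
Qed.

(** Lets an evaluation map be inverted by following it with a known isomorphism and recognising the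
    composite. *)
Lemma is_iso_cancell (C : category) (a b c : C) (g : hom b c) (f : hom a b) :
  is_iso g -> is_iso (compc g f) -> is_iso f.
Proof.
move=> [g' [g'g gg']] gf_iso.
rewrite -(comp1c f) -g'g -compcA; apply: is_iso_comp => //.
by exists g.
Qed.

Lemma is_iso_fmap (C D : category) (F : functor C D) (a b : C) (f : hom a b) :
  is_iso f -> is_iso (fmap F f).
Proof.
move=> [g [gf fg]]; exists (fmap F g).
by rewrite -!fmapM gf fg !fmap1.
Qed.

Lemma is_iso_op (C : category) (a b : C) (f : hom a b) :
  is_iso f -> @is_iso (op_cat C) b a f.
Proof. by move=> [g [gf fg]]; exists g. Qed.

(** For an isomorphism [f], the naturality square makes [fmap H f] after [eta a] invertible, and
    [fmap H f] cancels. This carries invertibility from the standard objects to everything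
    isomorphic to them. *)
Lemma natural_is_iso (C : category) (H : functor C C)
    (eta : forall a : C, hom a (H a)) (a b : C) :
  (forall (a b : C) (f : hom a b),
    compc (eta b) f = compc (fmap H f) (eta a)) ->
  isomorphic a b -> is_iso (eta b) -> is_iso (eta a).
Proof.
move=> eta_nat [f f_iso] eta_b.
apply: (is_iso_cancell (is_iso_fmap H f_iso)).
by rewrite -eta_nat; apply: is_iso_comp.
Qed.

Lemma nat_iso_sym (C D : category) (F G : functor C D) :
  nat_iso F G -> nat_iso G F.
Proof.
move=> [eta [eta_iso eta_nat]].
exists (fun a => sval (cid (eta_iso a))); split=> [a|a b f].
  by case: cid => g [gf fg]; exists (eta a).
case: cid => g [gf _] /=; case: cid => h [_ fh] /=.
(* Precompose with [eta a] after [h], move [eta a] across the square to become [eta b], and cancel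
   it against [g]. *)
by rewrite -[LHS]compc1 -fh -compcA (compcA _ _ h) -eta_nat !compcA gf comp1c.
Qed.

Section algdual_fspow_theory.
Variables (R : topComRingType) (X : Type).

(** The explicit maps are named because the composites below are computed from their values; mere
    existence of an isomorphism would not do. *)
Definition coord_hom : @hom (TopMod R) (algdual (fspow R X)) (funpow R X) :=
  ContLinear (@algdual_fspow_coord_continuous R X).

Definition form_hom : @hom (TopMod R) (funpow R X) (algdual (fspow R X)) :=
  ContLinear (@funpow_form_continuous R X).

Lemma coord_homK : compc form_hom coord_hom = idc _.
Proof.
apply: contLinear_ext => l; apply: linear_ext => p.
(* A form is determined by its values on the Dirac functions, since [p] is a finite combination of
   them. *)
have [A pA] := fspow_support p.
rewrite [in RHS](fspow_sum pA) linear_sum /= (pairingE _ pA).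
by apply: eq_bigr => x _; rewrite scalarZ.
Qed.

Lemma form_homK : compc coord_hom form_hom = idc _.
Proof.
by apply: contLinear_ext => f; apply/funext => x; exact: pairing_dirac.
Qed.

Lemma coord_hom_iso : is_iso coord_hom.
Proof. by exists form_hom; split; [exact: coord_homK|exact: form_homK]. Qed.

Lemma form_hom_iso : is_iso form_hom.
Proof. by exists coord_hom; split; [exact: form_homK|exact: coord_homK]. Qed.

End algdual_fspow_theory.

Section topmod_bidual.
Variable R : topComRingType.

Definition topmod_bidual : functor (TopMod R) (TopMod R) :=
  comp_functor (AlgDual R) (op_functor (TopDual R)).

Section eval.
Variable M : topModType R.

Fact topmod_eval_scalar (m : M) :
  scalar (fun l : topdual M => (val l : {scalar M}) m).
Proof. by []. Qed.

Definition topmod_eval_fun (m : M) : algdual (topdual M) :=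
  pack_linear (topmod_eval_scalar m).

Fact topmod_eval_linear : linear topmod_eval_fun.
Proof. by move=> a m n; apply: linear_ext => l; exact: scalarP. Qed.

(** Continuity into the weak-* topology is tested at each [l], where the composite is the continuous
    form [l] itself. *)
Fact topmod_eval_continuous : continuous (pack_linear topmod_eval_linear).
Proof.
apply: (is_initial_cont (@algdual_initial R (topdual M))) => l.
exact: (contdualP (val l)).1 (valP l).
Qed.

Definition topmod_eval : contLinear M (algdual (topdual M)) :=
  ContLinear topmod_eval_continuous.

End eval.

Lemma topmod_eval_natural (M N : TopMod R) (f : hom M N) :
  compc (topmod_eval N : hom N (topmod_bidual N)) f
  = compc (fmap topmod_bidual f) (topmod_eval M : hom M (topmod_bidual M)).
Proof. by apply: contLinear_ext => m; exact: linear_ext. Qed.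

Lemma topmod_eval_iso (rigR : rigid R) (M : topModType R) :
  topfree_module M ->
  is_iso (topmod_eval M : @hom (TopMod R) M (topmod_bidual M)).
Proof.
move=> [X MX]; apply: (natural_is_iso topmod_eval_natural MX).
have lambdaT := is_iso_fmap (AlgDual R) (is_iso_op (rigR X)).
apply: (is_iso_cancell (is_iso_comp (coord_hom_iso R X) lambdaT)).
(* Evaluation at [f] pulls back along [lambda] to [p |-> pairing p f], whose coordinate at [x] is
   [f x]. *)
rewrite (_ : compc _ _ = idc (funpow R X : TopMod R)); first exact: is_iso_id.
by apply: contLinear_ext => f; apply/funext => x; exact: pairing_dirac.
Qed.

End topmod_bidual.

Section mod_bidual.
Variable R : topComRingType.

Definition mod_bidual : functor (Mod R) (Mod R) :=
  comp_functor (TopDual R) (op_functor (AlgDual R)).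

Section eval.
Variable N : lmodType R.

Fact mod_eval_scalar (n : N) :
  scalar (fun l : algdual N => algdual_eval n l).
Proof. by []. Qed.

Fact mod_eval_continuous (n : N) :
  (pack_linear (mod_eval_scalar n) : algdual (algdual N)) \in contdual _.
Proof.
apply/contdualP.
exact: (@is_initial_eval _ _ _ _ (@algdual_initial R N) n).
Qed.

Definition mod_eval_fun (n : N) : topdual (algdual N) :=
  exist (fun l : algdual (algdual N) => l \in contdual _) _
    (mod_eval_continuous n).

Fact mod_eval_linear : linear mod_eval_fun.
Proof.
by move=> a m n; apply: val_inj; apply: linear_ext => l; exact: scalarP.
Qed.

Definition mod_eval : {linear N -> topdual (algdual N)} :=
  pack_linear mod_eval_linear.

End eval.

Lemma mod_eval_natural (M N : Mod R) (f : hom M N) :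
  compc (mod_eval N : hom N (mod_bidual N)) f
  = compc (fmap mod_bidual f) (mod_eval M : hom M (mod_bidual M)).
Proof.
by apply: linear_ext => m; apply: val_inj; exact: linear_ext.
Qed.

Lemma mod_eval_iso (rigR : rigid R) (N : lmodType R) :
  free_module N -> is_iso (mod_eval N : @hom (Mod R) N (mod_bidual N)).
Proof.
move=> [X NX]; apply: (natural_is_iso mod_eval_natural NX).
have formT := is_iso_fmap (TopDual R) (is_iso_op (form_hom_iso R X)).
apply: (is_iso_cancell formT).
(* Evaluation at [p], pulled back along [form_hom], is [f |-> pairing p f], that is, [lambda] at
   [p]. *)
rewrite (_ : compc _ _ = (lambda R X : @hom (Mod R) _ _)); first exact: rigR.
by apply: linear_ext => p; apply: val_inj; exact: linear_ext.
Qed.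

End mod_bidual.

Theorem theorem48 (R : topComRingType) (rigR : rigid R) :
  is_equivalence (Top rigR) /\
  equivalence_inverse (Top rigR) (op_functor (Alg R)).
Proof.
suff TopAlg : equivalence_inverse (Top rigR) (op_functor (Alg R)).
  by split=> //; exists (op_functor (Alg R)).
(* Both evaluations run against the required direction: the first because its source category is an
   opposite, the second because it goes from the identity to the bidual. *)
split; apply: nat_iso_sym.
  exists (fun M : TopFreeMod R => topmod_eval (sval M)); split=> [[M MX]|M N f].
    have [g [gev evg]] := topmod_eval_iso rigR MX.
    by exists g.
  (* In the opposite category [f] is a continuous map from [N] to [M], so the square is read
     backwards. *)
  exact/esym/(@topmod_eval_natural R (sval N) (sval M) f).
exists (fun N : FreeMod R => mod_eval (sval N)); split=> [[N NX]|M N f].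
  exact: (mod_eval_iso rigR NX).
exact: (@mod_eval_natural R (sval M) (sval N) f).
Qed.
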